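(* For every large $n$ there is a set $E$ of $\approx n$ points in $\mathbb{R}^3$ such that the number of pairs $(y,z)\in E^2$ with $\angle(0,y,z)=\pi/2$ (where $0$ is the origin) is $\approx n^2$.
   Context: $\angle(x,y,z)\in[0,\pi]$ denotes the angle at $y$ between $x-y$ and $z-y$ (for $x\ne y\ne z$). $X\approx Y$ means $cY\le X\le CY$ for all $n>N$ with positive constants $c,C,N$ independent of $n$. *)

(* Defs.v *)
From HB Require Import structures.
From mathcomp Require Import all_boot all_order all_algebra.
From mathcomp Require Import finmap.
From mathcomp Require Import all_classical all_reals all_analysis.

Set Implicit Arguments.
Unset Strict Implicit.
Unset Printing Implicit Defensive.

Import Order.TTheory GRing.Theory Num.Theory.
Local Open Scope ring_scope.

Definition dot (R : realType) (d : nat) (u v : 'rV[R]_d) : R :=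
  \sum_(i < d) u ord0 i * v ord0 i.

(* The library norm on row vectors is the sup norm. *)
Definition norm2 (R : realType) (d : nat) (u : 'rV[R]_d) : R :=
  Num.sqrt (dot u u).

(* Only meaningful when x != y and y != z: otherwise the quotient is 0 and the
   value is acos 0 = pi / 2. *)
Definition angle (R : realType) (d : nat) (x y z : 'rV[R]_d) : R :=
  acos (dot (x - y) (z - y) / (norm2 (x - y) * norm2 (z - y))).

(* Ordered pairs; the first two conditions exclude undefined angles. *)
Definition right_angle_pairs (R : realType) (d : nat) (E : {fset 'rV[R]_d}) :
    {fset 'rV[R]_d * 'rV[R]_d} :=
  [fset p in (E `*` E)%fset |
     [&& 0 != p.1, p.1 != p.2 & angle 0 p.1 p.2 == pi / 2]]%fset.

Definition same_order (R : realType) (X Y : nat -> R) : Prop :=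
  exists c C N : R, [/\ 0 < c, 0 < C, 0 < N &
    forall n : nat, N < n%:R -> c * Y n <= X n <= C * Y n].

(* Main.v *)
Require Import Defs.
From HB Require Import structures.
From mathcomp Require Import all_boot all_order all_algebra.
From mathcomp Require Import finmap.
From mathcomp Require Import all_classical all_reals all_analysis.
From mathcomp Require Import ring.

(** The angle (0, y, z) is right exactly when y.z = |y|^2, i.e. when y lies on
    the sphere with diameter [0, z].  The spheres obtained for z on the line
    {(1, 0, t)} all contain the circle y1^2 + y2^2 = y1, y3 = 0.  Taking n
    points on the circle and n points on the line gives n^2 right angles. *)

Set Implicit Arguments.
Unset Strict Implicit.
Unset Printing Implicit Defensive.

Import Order.TTheory GRing.Theory Num.Theory.
Local Open Scope ring_scope.

Lemma dotBr (R : realType) (d : nat) (u v w : 'rV[R]_d) :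
  dot u (v - w) = dot u v - dot u w.
Proof.
by rewrite /dot -sumrB; apply: eq_bigr => i _; rewrite !mxE; ring.
Qed.

Lemma dotNl (R : realType) (d : nat) (u v : 'rV[R]_d) : dot (- u) v = - dot u v.
Proof. by rewrite /dot -sumrN; apply: eq_bigr => i _; rewrite !mxE mulNr. Qed.

(** The numerator -y.(z - y) of the cosine vanishes, so the quotient is 0 and [acos 0] is pi / 2. *)
Lemma angle0_right (R : realType) (d : nat) (y z : 'rV[R]_d) :
  dot y z = dot y y -> angle 0 y z = pi / 2.
Proof.
by move=> yz; rewrite /angle sub0r dotNl dotBr yz subrr oppr0 mul0r acos0.
Qed.

Definition vec3 (R : realType) (a b c : R) : 'rV[R]_3 :=
  \row_(i < 3) [:: a; b; c]`_i.

Lemma dot_vec3 (R : realType) (a b c a' b' c' : R) :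
  dot (vec3 a b c) (vec3 a' b' c') = a * a' + b * b' + c * c'.
Proof. by rewrite /dot !big_ord_recl big_ord0 !mxE /= addr0 addrA. Qed.

Lemma vec3_inj (R : realType) (a b c a' b' c' : R) :
  vec3 a b c = vec3 a' b' c' -> [/\ a = a', b = b' & c = c'].
Proof.
move=> /rowP e; split.
- by have := e (@Ordinal 3 0 isT); rewrite !mxE.
- by have := e (@Ordinal 3 1 isT); rewrite !mxE.
- by have := e (@Ordinal 3 2 isT); rewrite !mxE.
Qed.

(** Rational parametrisation of the circle by slope: the point other than the origin where the line
    y2 = s y1 meets y1^2 + y2^2 = y1 in the plane y3 = 0. *)
Definition circle_point (R : realType) (s : nat) : 'rV[R]_3 :=
  vec3 (1 + s%:R ^+ 2)^-1 (s%:R / (1 + s%:R ^+ 2)) 0.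

(* The successor keeps the line points away from (1, 0, 0), which is
   [circle_point 0]. *)
Definition line_point (R : realType) (t : nat) : 'rV[R]_3 := vec3 1 0 t.+1%:R.

Lemma circle_denom_neq0 (R : realType) (s : nat) : 1 + s%:R ^+ 2 != 0 :> R.
Proof. by rewrite gt_eqF // ltr_wpDr // sqr_ge0. Qed.

Lemma circle_point_inj (R : realType) : injective (@circle_point R).
Proof.
move=> s t /vec3_inj[/invr_inj e1 e2 _].
(* Equal first coordinates make the denominators equal, so they cancel from the second coordinates
   and leave the slopes. *)
move: e2; rewrite e1 => /(mulIf (invr_neq0 (circle_denom_neq0 R t))).
by move/eqP; rewrite eqr_nat => /eqP.
Qed.

Lemma line_point_inj (R : realType) : injective (@line_point R).
Proof. by move=> s t /vec3_inj[_ _ /eqP]; rewrite eqr_nat eqSS => /eqP. Qed.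

Lemma circle_point_neq0 (R : realType) (s : nat) : 0 != circle_point R s.
Proof.
apply/eqP => /rowP /(_ ord0) /eqP; rewrite !mxE /= eq_sym invr_eq0.
exact/negP/circle_denom_neq0.
Qed.

Lemma circle_line_neq (R : realType) (s t : nat) :
  circle_point R s != line_point R t.
Proof.
by apply/eqP => /vec3_inj[_ _ /eqP]; rewrite eq_sym pnatr_eq0.
Qed.

(** With y on the circle and z = (1, 0, t + 1), y.z is y1 because y3 = 0, and y1 = |y|^2 is the
    equation of the circle. *)
Lemma dot_circle_line (R : realType) (s t : nat) :
  dot (circle_point R s) (line_point R t) =
  dot (circle_point R s) (circle_point R s).
Proof. by rewrite !dot_vec3; field; exact: circle_denom_neq0. Qed.

Definition circle_line_config (R : realType) (n : nat) : {fset 'rV[R]_3} :=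
  ([fset circle_point R i | i in iota 0 n] `|`
   [fset line_point R i | i in iota 0 n])%fset.

Lemma card_imfset_iota (K : choiceType) (f : nat -> K) (n : nat) :
  injective f -> #|` [fset f i | i in iota 0 n]%fset| = n.
Proof.
move=> f_inj; rewrite card_imfset //=.
by rewrite undup_id ?iota_uniq // size_iota.
Qed.

Lemma card_fsetM (K K' : choiceType) (A : {fset K}) (B : {fset K'}) :
  #|` (A `*` B)%fset| = (#|` A| * #|` B|)%N.
Proof.
(* Two duplicate-free lists with the same members are permutations of each other. *)
rewrite -(size_allpairs pair); apply/perm_size/uniq_perm.
- exact: fset_uniq.
- by apply: allpairs_uniq => // -[? ?] [? ?].
- move=> [x y]; rewrite in_fsetM; apply/andP/allpairsP => [[xA yB]|].
    by exists (x, y).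
  by case=> -[x' y'] /= [? ? [-> ->]].
Qed.

(** The circle points alone give the lower bound; the upper bound is inclusion-exclusion with the
    intersection term dropped. *)
Lemma card_circle_line_config (R : realType) (n : nat) :
  (n <= #|` circle_line_config R n| <= 2 * n)%N.
Proof.
have cY := card_imfset_iota n (@circle_point_inj R).
have cZ := card_imfset_iota n (@line_point_inj R).
apply/andP; split.
  by rewrite -[leqLHS]cY; apply/fsubset_leq_card/fsubsetUl.
by rewrite cardfsU cY cZ mul2n -addnn leq_subr.
Qed.

Lemma leq_card_right_angle_pairs (R : realType) (d : nat)
    (E : {fset 'rV[R]_d}) :
  (#|` right_angle_pairs E| <= #|` E| ^ 2)%N.
Proof.
rewrite -mulnn -card_fsetM; apply: fsubset_leq_card.
by apply/fsubsetP => p; rewrite !inE => /andP[].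
Qed.

Lemma right_angle_pairs_circle_line (R : realType) (n : nat) :
  (n ^ 2 <= #|` right_angle_pairs (circle_line_config R n)|)%N.
Proof.
have cY := card_imfset_iota n (@circle_point_inj R).
have cZ := card_imfset_iota n (@line_point_inj R).
(* Read n^2 as the size of the product of the circle part and the line part, which is then included
   in the set of right-angle pairs. *)
rewrite -mulnn -[X in (X * _)%N]cY -[X in (_ * X <= _)%N]cZ -card_fsetM.
apply: fsubset_leq_card; apply/fsubsetP => -[y z].
rewrite in_fsetM /= => /andP[yY zZ].
rewrite !inE /= yY zZ orbT /=.
have /imfsetP[i _ ->] := yY; have /imfsetP[j _ ->] := zZ.
rewrite circle_point_neq0 circle_line_neq /=.
exact/eqP/angle0_right/dot_circle_line.
Qed.

Theorem theorem6p1 (R : realType) :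
  exists E : nat -> {fset 'rV[R]_3},
    same_order (fun n => #|` E n |%:R : R) (fun n => n%:R) /\
    same_order (fun n => #|` right_angle_pairs (E n) |%:R : R)
               (fun n => n%:R ^+ 2).
Proof.
exists (circle_line_config R); split.
- exists 1, 2, 1; split => // n _.
  by rewrite mul1r -natrM !ler_nat card_circle_line_config.
(* The constant 4 is the square of the 2 in the bound 2n on the number of points. *)
- exists 1, 4, 1; split => // n _.
  rewrite mul1r -natrX -natrM !ler_nat right_angle_pairs_circle_line /=.
  apply: leq_trans (leq_card_right_angle_pairs _) _.
  have /andP[_ cE] := card_circle_line_config R n.
  by rewrite (_ : 4 = 2 ^ 2)%N // -expnMn leq_exp2r.
Qed.
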